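(* Let $\vec{A}=(A_0,A_1)$ be a Banach pair and let $F$ be a parameter for the $K$-method on $[0,1]$. Suppose that the operator $Tf(t):=f(t^2)/t$ is bounded on $F$. Then there exist constants $c,C>0$ (depending only on $F$, and not on $a$ or $q$) such that for all $a\in\langle\vec{A}\rangle_F^K$ and all $q\in[1,\infty]$, $$c\,\Vert a\Vert_{\langle\vec{A}\rangle_F^K}\le \Big\Vert\, t\cdot\Vert a\Vert_{\langle\vec{A}\rangle_{\theta(t),q}^{K\blacktriangleleft}}\Big\Vert_F\le C\,\Vert a\Vert_{\langle\vec{A}\rangle_F^K},\qquad \theta(t)=1+\frac{1}{2\log(t/e)},\ 0<t\le 1 .$$
   Context: A Banach pair $\vec A=(A_0,A_1)$ consists of two Banach spaces continuously embedded in a common Hausdorff topological vector space. For $x\in A_0+A_1$, $t>0$, the $K$-functional is $K(t,x;\vec A)=\inf\{\Vert a_0\Vert_{A_0}+t\Vert a_1\Vert_{A_1}: x=a_0+a_1,\ a_i\in A_i\}$. $L^\infty=L^\infty(0,1)$ and $L^\infty(1/t)$ is the space of measurable $f$ on $(0,1)$ with $\Vert f\Vert_{L^\infty(1/t)}=\Vert f(t)/t\Vert_{L^\infty}<\infty$. A parameter for the $K$-method on $[0,1]$ is a Banach lattice $F$ of measurable functions on $(0,1)$ with continuous embeddings $L^\infty(1/t)\subset F\subset L^\infty$. Then $\langle\vec A\rangle_F^K=\{x\in A_0+A_1:\Vert x\Vert_{\langle\vec A\rangle_F^K}:=\Vert K(\cdot,x;\vec A)\Vert_F<\infty\}$. For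 $0<\theta<1$, $1\le q<\infty$: $\Vert x\Vert_{\langle\vec A\rangle_{\theta,q}^{K\blacktriangleleft}}=(q\theta(1-\theta))^{1/q}\left(\int_0^1 (s^{-\theta}K(s,x;\vec A))^q\frac{ds}{s}\right)^{1/q}$, and for $q=\infty$: $\Vert x\Vert_{\langle\vec A\rangle_{\theta,\infty}^{K\blacktriangleleft}}=\sup_{0<s<1}s^{-\theta}K(s,x;\vec A)$. The value is $+\infty$ if $x$ is not in the space. *)

(* Defs.v *)
From HB Require Import structures.
From mathcomp Require Import all_boot all_order all_algebra.
From mathcomp Require Import all_classical all_reals all_analysis.

Set Implicit Arguments.
Unset Strict Implicit.
Unset Printing Implicit Defensive.

Import Order.TTheory GRing.Theory Num.Theory.
Import numFieldNormedType.Exports.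

Local Open Scope classical_set_scope.
Local Open Scope ring_scope.

(* Real scalars: a complex Banach pair is covered by restriction of scalars,
   since everything below depends only on addition and on the norms. *)
Record banach_pair (R : realType) := BanachPair {
  bp0 : completeNormedModType R;
  bp1 : completeNormedModType R;
  ambient : topologicalLmodType R;
  ambient_hausdorff : hausdorff_space ambient;
  emb0 : {linear bp0 -> ambient};
  emb1 : {linear bp1 -> ambient};
  emb0_inj : injective emb0;
  emb1_inj : injective emb1;
  emb0_continuous : continuous emb0;
  emb1_continuous : continuous emb1 }.

Definition sum_space (R : realType) (A : banach_pair R) : set (ambient A) :=
  [set x | exists (a0 : bp0 A) (a1 : bp1 A), x = emb0 A a0 + emb1 A a1].

(* Equal to +oo when x is outside A_0 + A_1. *)
Definition Kfun (R : realType) (A : banach_pair R) (t : R) (x : ambient A)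
    : \bar R :=
  ereal_inf [set (`|a.1| + t * `|a.2|)%:E | a in
    [set a : bp0 A * bp1 A | x = emb0 A a.1 + emb1 A a.2]].

Definition I01 (R : realType) : set R := `]0, 1[%classic.
Arguments I01 R : clear implicits.

Definition ae01 (R : realType) (P : R -> Prop) : Prop :=
  \forall t \ae (@lebesgue_measure R), I01 R t -> P t.

Definition Linfty_norm01 (R : realType) (f : R -> R) : \bar R :=
  Lnorm (@lebesgue_measure R) +oo%E (EFin \o (f \_ (I01 R))).

(* A Banach lattice of (classes of) measurable functions on (0,1), given by
   the set of its representatives: only the values on (0,1) matter, and up to
   null sets.  Invariance of membership and norm under a.e. equality is the
   special case |g| = |f| of the ideal property bfl_ideal. *)
Record banach_function_lattice (R : realType) := BanachFunctionLattice {
  bfl_set : set (R -> R);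
  bfl_norm : (R -> R) -> R;
  bfl_measurable : forall f : R -> R, bfl_set f -> measurable_fun (I01 R) f;
  bfl_0 : bfl_set (fun=> 0);
  bfl_add : forall f g, bfl_set f -> bfl_set g ->
    bfl_set (fun t => f t + g t);
  bfl_scale : forall (k : R) f, bfl_set f -> bfl_set (fun t => k * f t);
  bfl_normD : forall f g, bfl_set f -> bfl_set g ->
    bfl_norm (fun t => f t + g t) <= bfl_norm f + bfl_norm g;
  bfl_normZ : forall (k : R) f, bfl_set f ->
    bfl_norm (fun t => k * f t) = `|k| * bfl_norm f;
  bfl_norm0 : forall f : R -> R, bfl_set f -> bfl_norm f = 0 ->
    ae01 (fun t => f t = 0);
  bfl_ideal : forall f g : R -> R, bfl_set f -> measurable_fun (I01 R) g ->
    ae01 (fun t => `|g t| <= `|f t|) -> bfl_set g /\ bfl_norm g <= bfl_norm f;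
  bfl_complete : forall u : nat -> R -> R, (forall n, bfl_set (u n)) ->
    (forall e : R, 0 < e -> exists N : nat, forall m n : nat,
      (N <= m)%N -> (N <= n)%N -> bfl_norm (fun t => u m t - u n t) < e) ->
    exists2 f, bfl_set f &
      bfl_norm (fun t => u n t - f t) @[n --> \oo] --> (0 : R) }.

(* L^oo(1/t) `<=` F `<=` L^oo, both inclusions being continuous. *)
Definition is_Kparameter (R : realType) (F : banach_function_lattice R)
    : Prop :=
  (exists M : R, forall f : R -> R, measurable_fun (I01 R) f ->
     (Linfty_norm01 (fun t => f t / t)%R < +oo)%E ->
     bfl_set F f /\ ((bfl_norm F f)%:E <= M%:E * Linfty_norm01 (fun t => f t / t)%R)%E)
  /\
  (exists M : R, forall f : R -> R, bfl_set F f ->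
     (Linfty_norm01 f <= (M * bfl_norm F f)%:E)%E).

Definition bounded_on (R : realType) (F : banach_function_lattice R)
    (T : (R -> R) -> (R -> R)) : Prop :=
  exists M : R, forall f, bfl_set F f -> bfl_set F (T f) /\ bfl_norm F (T f) <= M * bfl_norm F f.

(* The norm of F on extended real-valued functions; +oo outside F. *)
Definition enorm (R : realType) (F : banach_function_lattice R)
    (g : R -> \bar R) : \bar R :=
  if `[< ae01 (fun t => g t \is a fin_num) /\ bfl_set F (fine \o g) >]
  then (bfl_norm F (fine \o g))%:E else +oo%E.

Definition Knorm (R : realType) (A : banach_pair R)
    (F : banach_function_lattice R) (x : ambient A) : \bar R :=
  enorm F (fun t => Kfun t x).

Definition Kspace (R : realType) (A : banach_pair R)
    (F : banach_function_lattice R) : set (ambient A) :=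
  [set x | sum_space x /\ (Knorm F x < +oo)%E].

(* The norm with superscript K and black triangle; meant for 0 < th < 1 and
   1 <= q <= +oo, the value at q = -oo being a dummy. *)
Definition Knorm_theta (R : realType) (A : banach_pair R) (th : R) (q : \bar R)
    (x : ambient A) : \bar R :=
  match q with
  | r%:E =>
      (((r * th * (1 - th)) `^ r^-1)%:E *
       (\int[@lebesgue_measure R]_(s in I01 R)
          (((s `^ (- th))%:E * Kfun s x) `^ r * (s^-1)%:E)) `^ r^-1)%E
  | +oo%E => ereal_sup [set ((s `^ (- th))%:E * Kfun s x)%E | s in I01 R]
  | -oo%E => 0%E
  end.

Definition theta (R : realType) (t : R) : R := 1 + (2 * ln (t / expR 1))^-1.

(* Main.v *)
Require Import Defs.
From HB Require Import structures.
From mathcomp Require Import all_boot all_order all_algebra.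
From mathcomp Require Import all_classical all_reals all_analysis.
From mathcomp Require Import measurable_realfun ess_sup_inf ring lra.
Import Order.TTheory GRing.Theory Num.Theory.
Import numFieldNormedType.Exports.
Local Open Scope classical_set_scope.
Local Open Scope ring_scope.
Set Implicit Arguments.
Unset Strict Implicit.
Unset Printing Implicit Defensive.

(* Write k for the K-functional of a, L = ln(e/t) and d = delta t = (1 - theta t)/2 = 1/(4L).
   Only two properties of k are needed: k >= 0, and k(s)/s is nonincreasing.
   Lower bound: restricting the norm of order (theta, q) to s <= t, where
   k(s) >= s k(t)/t, gives t * norm >= t^(1 - theta) k(t)/2 >= e^(-1/2) k(t)/2.
   Upper bound: if t s^(d - 1) k(s) <= D for all s, then integrating s^(d q - 1)
   gives t * norm <= 2 D uniformly in q, so one needs a majorant D(t) of these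
   quantities in F.  The iterates T^n k(t) = t k(t^(2^n))/t^(2^n) have F-norm at
   most M^n times that of k.  For t <= 1/e and n minimal with t^(2^n) <= s, the
   factor s^d <= exp(-2^n/16) beats (2M)^n, so a multiple of the F-sum of
   (2M)^(-n) T^n k is a majorant.  For t > 1/e, s^(d - 1) is bounded by its value
   at some t1 in (e^-2, e^-1), and the embedding of F in L^oo bounds the majorant
   at t1, giving a multiple of the function t. *)

(** * Powers and their integrals near 0 *)

Lemma ge0_le_poweR (R : realType) (r : R) (x y : \bar R) :
  0 <= r -> (0 <= x -> x <= y -> x `^ r <= y `^ r)%E.
Proof.
move=> r0 x0 xy; apply: gt0_ler_poweR => //; rewrite in_itv/= leey andbT//.
exact: le_trans xy.
Qed.

Lemma integral_powR_cc (R : realType) (a e b : R) : a != 0 -> 0 < e -> e < b ->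
  (\int[@lebesgue_measure R]_(s in `[e, b]) (s `^ (a - 1))%:E =
   ((b `^ a - e `^ a) / a)%:E)%E.
Proof.
move=> a0 e0 eb.
have dF (c x : R) : 0 < x -> derivable (fun s : R => s `^ c) x 1.
  by move=> x0; apply: derivable_powR; rewrite in_itv/= x0.
have cF (c x : R) : 0 < x -> {for x, continuous (fun s : R => s `^ c)}.
  by move=> x0; apply/differentiable_continuous/derivable1_diffP/dF.
rewrite (@continuous_FTC2 _ _ (fun s => a^-1 * s `^ a)) //.
- by rewrite -EFinB -mulrBr mulrC.
- apply: derivable_within_continuous => x; rewrite in_itv/= => /andP[ex _].
  by apply: dF; exact: lt_le_trans ex.
- split.
  + move=> x; rewrite in_itv/= => /andP[ex _].
    by apply: derivableZ; apply: dF; exact: lt_trans ex.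
  + by apply: cvg_at_right_filter; apply: cvgMr; exact: cF.
  + by apply: cvg_at_left_filter; apply: cvgMr; apply: cF; exact: lt_trans eb.
- move=> x; rewrite in_itv/= => /andP[ex _].
  have x0 : 0 < x by exact: lt_trans ex.
  rewrite derive1E deriveZ; last exact: dF.
  have [_ ->] := @is_derive1_powR R a x x0.
  by rewrite /GRing.scale/= mulrA mulVf // mul1r.
Qed.

Lemma measurable_I01 (R : realType) : measurable (I01 R).
Proof. exact: measurable_itv. Qed.

Lemma measurable_powR_EFin (R : realType) (a : R) (D : set R) :
  measurable_fun D (EFin \o (fun s : R => s `^ a)).
Proof. by apply/measurable_EFinP; apply: measurable_funTS; exact: measurable_powR. Qed.

(** Exhausts (0,1) by the intervals [1/(n+2), 1]. On each of them the integral is (1 - e^a)/a <=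
    1/a, and monotone convergence passes to the limit. *)
Lemma integral_powR_I01_le (R : realType) (a : R) : 0 < a ->
  (\int[@lebesgue_measure R]_(s in I01 R) (s `^ (a - 1))%:E <= (a^-1)%:E)%E.
Proof.
move=> a0.
(* The shift by 2 keeps [e n] below 1 already at n = 0, so that every interval is nondegenerate. *)
pose e n : R := (n.+2%:R)^-1.
have e0 n : 0 < e n by rewrite invr_gt0.
have e1 n : e n < 1 by rewrite invf_lt1// ltr1n.
pose J n : set R := `[e n, 1]%classic.
have ndJ : nondecreasing_seq J.
  move=> m n mn; rewrite subsetEset; apply: subset_itvr; rewrite bnd_simp.
  by rewrite lef_pV2 ?posrE// ler_nat.
have cvJ : (\int[@lebesgue_measure R]_(s in J i) (s `^ (a - 1))%:E @[i --> \oo] -->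
    \int[@lebesgue_measure R]_(s in \bigcup_i J i) (s `^ (a - 1))%:E)%E.
  apply: ge0_nondecreasing_set_cvg_integral => //.
  - by move=> n; exact: measurable_itv.
  - by move=> n; exact: measurable_powR_EFin.
  - by move=> n s _; rewrite lee_fin powR_ge0.
apply: (@le_trans _ _
  (\int[@lebesgue_measure R]_(s in \bigcup_i J i) (s `^ (a - 1))%:E)%E).
  apply: ge0_subset_integral => //.
  - exact: measurable_I01.
  - by apply: bigcupT_measurable => n; exact: measurable_itv.
  - exact: measurable_powR_EFin.
  - by move=> s _; rewrite lee_fin powR_ge0.
  - move=> s; rewrite /I01/= in_itv/= => /andP[s0 s1].
    exists (Num.truncn s^-1) => //=.
    rewrite /J/= in_itv/= (ltW s1) andbT /e invf_ple ?posrE//.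
    by apply: (le_trans (ltW (truncnS_gt _))); rewrite ler_nat.
rewrite -(cvg_lim _ cvJ)//; apply: lime_le; first by apply/cvg_ex; eexists; exact: cvJ.
apply: nearW => n; rewrite integral_powR_cc ?gt_eqF// lee_fin powR1.
by rewrite ler_pdivrMr// mulVf ?gt_eqF// lerBlDr lerDl powR_ge0.
Qed.

(** The integral over (0,t] dominates those over [e,t], and these tend to t^a/a as e decreases to 0
    because a > 0. *)
Lemma integral_powR_oc_ge (R : realType) (a t : R) : 0 < a -> 0 < t ->
  ((t `^ a / a)%:E <=
   \int[@lebesgue_measure R]_(s in `]0%R, t]) (s `^ (a - 1))%:E)%E.
Proof.
move=> a0 t0.
have H e : 0 < e -> e < t -> (((t `^ a - e `^ a) / a)%:E <=
   \int[@lebesgue_measure R]_(s in `]0%R, t]) (s `^ (a - 1))%:E)%E.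
  move=> e0 et; rewrite -integral_powR_cc ?gt_eqF//.
  apply: ge0_subset_integral => //.
  - exact: measurable_powR_EFin.
  - by move=> s _; rewrite lee_fin powR_ge0.
  - by move=> s /=; rewrite !in_itv/= => /andP[es ->]; rewrite (lt_le_trans e0).
have cv : ((t `^ a - e `^ a) / a)%:E @[e --> (0:R)^'+] --> (t `^ a / a)%:E.
  apply: cvg_EFin; first exact: nearW.
  apply: cvgMl; rewrite -[X in _ --> X]subr0.
  by apply: cvgB; [exact: cvg_cst | exact: powR_cvg0].
rewrite -(cvg_lim _ cv)//; apply: lime_le; first by apply/cvg_ex; eexists; exact: cv.
near=> e; apply: H; near: e; [exact: nbhs_right_gt | exact: nbhs_right_lt].
Unshelve. all: by end_near. Qed.

Lemma powRK (R : realType) (r y : R) : 0 < r -> 0 <= y -> (y `^ r) `^ r^-1 = y.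
Proof. by move=> r0 y0; rewrite -powRrM mulfV ?gt_eqF// powRr1. Qed.

(** * Two-sided bounds on the (theta, q) norm for fixed theta, uniform in q *)

Section Knorm_theta_bounds.
Variables (R : realType) (A : banach_pair R) (x : ambient A) (k : R -> R).
Hypothesis mk : measurable_fun (I01 R) k.
Hypothesis Kk : forall s, I01 R s -> Kfun s x = (k s)%:E.
Hypothesis k0 : forall s, I01 R s -> 0 <= k s.

Lemma I01_gt0 (s : R) : I01 R s -> 0 < s.
Proof. by rewrite /I01/= in_itv/= => /andP[]. Qed.

Lemma I01_lt1 (s : R) : I01 R s -> s < 1.
Proof. by rewrite /I01/= in_itv/= => /andP[]. Qed.

Lemma Knorm_theta_EFin (th r : R) :
  (Knorm_theta th r%:E x = ((r * th * (1 - th)) `^ r^-1)%:E *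
    (\int[@lebesgue_measure R]_(s in I01 R)
       ((s `^ (- th) * k s) `^ r * s^-1)%:E) `^ r^-1)%E.
Proof.
rewrite /Knorm_theta; congr (_ * _ `^ _)%E; apply: eq_integral => s.
by rewrite inE => /Kk ->.
Qed.

Lemma measurable_Kintegrand (th r : R) :
  measurable_fun (I01 R) (fun s => (s `^ (- th) * k s) `^ r * s^-1).
Proof.
apply: measurable_funM.
  apply: (measurableT_comp (measurable_powR r)).
  by apply: measurable_funM => //; apply: measurable_funTS; exact: measurable_powR.
apply: (@eq_measurable_fun _ _ _ _ _ (fun s : R => s `^ (-1))).
  by move=> s; rewrite inE => /I01_gt0/ltW s0; rewrite powR_inv1.
by apply: measurable_funTS; exact: measurable_powR.
Qed.

Lemma Kintegrand_ge0 (th r s : R) : I01 R s ->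
  0 <= (s `^ (- th) * k s) `^ r * s^-1.
Proof. by move=> /I01_gt0/ltW s0; rewrite mulr_ge0 ?powR_ge0// invr_ge0. Qed.

(** With d = (1 - th)/2 the integrand is at most B^r s^(d r - 1), whose integral is at most B^r/(d
    r). The normalization r th (1 - th) cancels both r and 1 - th and leaves 2 th B^r, whose r-th
    root is at most 2 B because th < 1 <= r. *)
Lemma Knorm_theta_le (th B : R) (q : \bar R) : 0 < th < 1 -> (1 <= q)%E ->
  0 <= B -> (forall s, I01 R s -> s `^ (- th) * k s <= B * s `^ ((1 - th) / 2)) ->
  (Knorm_theta th q x <= (2 * B)%:E)%E.
Proof.
move=> /andP[th0 th1] q1 B0 kB.
set d : R := (1 - th) / 2 in kB.
have d0 : 0 < d by rewrite divr_gt0// subr_gt0.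
case: q q1 => [r| |]//= r1; last first.
  apply: ge_ereal_sup => _ [s sI <-]; rewrite Kk// -EFinM lee_fin.
  apply: (le_trans (kB _ sI)); rewrite mulrC ler_wpM2r//.
  have -> : 2 = 1 + 1 :> R by [].
  rewrite ler_wpDr// -(powRr0 s) ger_powR// ?(I01_gt0 sI)//=; last exact: ltW.
  by rewrite ltW// I01_lt1.
rewrite lee_fin in r1.
have r0 : 0 < r by exact: lt_le_trans r1.
rewrite -[leLHS]/(Knorm_theta th r%:E x) Knorm_theta_EFin.
set I := (X in (_ * X `^ _)%E).
have dr0 : 0 < d * r by rewrite mulr_gt0.
have I0 : (0 <= I)%E.
  by apply: integral_ge0 => s sI; rewrite lee_fin Kintegrand_ge0.
have IB : (I <= (B `^ r / (d * r))%:E)%E.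
  apply: (@le_trans _ _ (\int[@lebesgue_measure R]_(s in I01 R)
      ((B `^ r)%:E * (s `^ (d * r - 1))%:E))%E).
    apply: ge0_le_integral => //.
    - exact: measurable_I01.
    - by move=> s sI; rewrite lee_fin Kintegrand_ge0.
    - by apply/measurable_EFinP; exact: measurable_Kintegrand.
    - apply: emeasurable_funM; first exact: measurable_cst.
      exact: measurable_powR_EFin.
    - move=> s sI; have s0 := I01_gt0 sI; rewrite -EFinM lee_fin.
      rewrite powRB ?(gt_eqF s0) ?implybT// powRr1 ?(ltW s0)// mulrA.
      rewrite ler_wpM2r ?invr_ge0 ?(ltW s0)// powRrM -powRM ?powR_ge0//.
      apply: ge0_ler_powR; rewrite ?nnegrE ?(ltW r0)// ?mulr_ge0 ?powR_ge0 ?k0//.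
      exact: kB.
  rewrite ge0_integralZl_EFin ?powR_ge0//.
  - by rewrite EFinM; apply: lee_wpmul2l; [exact: powR_ge0|exact: integral_powR_I01_le].
  - exact: measurable_I01.
  - by move=> s _; rewrite lee_fin powR_ge0.
  - exact: measurable_powR_EFin.
have c0 : 0 <= r * th * (1 - th).
  by rewrite !mulr_ge0 ?ltW// subr_gt0.
apply: (@le_trans _ _ (((r * th * (1 - th)) `^ r^-1)%:E *
    ((B `^ r / (d * r))%:E `^ r^-1))%E).
  apply: lee_wpmul2l; first exact: powR_ge0.
  apply: gt0_ler_poweR => //; first by rewrite invr_ge0 ltW.
  - by rewrite in_itv/= I0 leey.
  - by rewrite in_itv/= leey lee_fin divr_ge0 ?powR_ge0// ltW.
rewrite poweR_EFin -EFinM lee_fin -powRM ?divr_ge0 ?powR_ge0// ?(ltW dr0)//.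
have -> : r * th * (1 - th) * (B `^ r / (d * r)) = 2 * th * B `^ r.
  by rewrite /d; field; rewrite !gt_eqF// subr_gt0.
rewrite -[leRHS](powRK r0) ?mulr_ge0//.
apply: ge0_ler_powR;
  rewrite ?nnegrE ?powR_ge0 ?mulr_ge0 ?powR_ge0 ?invr_ge0 ?(ltW r0) ?(ltW th0)//.
rewrite powRM// ler_wpM2r ?powR_ge0//.
apply: (@le_trans _ _ 2); last by rewrite le1r_powR// ler1n.
by rewrite -[leRHS]mulr1 ler_wpM2l// ltW.
Qed.

(** Only s <= t is kept, where k(s) >= m s with m = k(t)/t. The integral is then at least m^r t^a/a
    with a = (1 - th) r, and the normalization turns this into th (m t^(1 - th))^r. Since (1/2)^r <=
    1/2 <= th, the r-th root costs at most a factor 2. For q = +oo the value at s = t suffices. *)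
Lemma Knorm_theta_ge (th t : R) (q : \bar R) : 2^-1 <= th < 1 -> (1 <= q)%E ->
  I01 R t -> (forall s, I01 R s -> s <= t -> s * k t <= t * k s) ->
  ((t `^ (- th) * k t / 2)%:E <= Knorm_theta th q x)%E.
Proof.
move=> /andP[thh th1] q1 tI kt.
have t0 := I01_gt0 tI.
have th0 : 0 < th by apply: lt_le_trans thh; rewrite invr_gt0.
case: q q1 => [r| |]//= r1; last first.
  apply: le_ereal_sup_tmp; eexists; first by exists t; [exact: tI|reflexivity].
  rewrite Kk// -EFinM lee_fin ler_pdivrMr// ler_peMr ?mulr_ge0 ?powR_ge0 ?k0//.
  by rewrite ler1n.
rewrite lee_fin in r1.
have r0 : 0 < r by exact: lt_le_trans r1.
rewrite -[leRHS]/(Knorm_theta th r%:E x) Knorm_theta_EFin.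
set I := (X in (_ * X `^ _)%E).
pose m := k t / t; pose a := (1 - th) * r.
have m0 : 0 <= m by rewrite divr_ge0 ?k0// ltW.
have a0 : 0 < a by rewrite mulr_gt0// subr_gt0.
have I0 : (0 <= I)%E.
  by apply: integral_ge0 => s sI; rewrite lee_fin Kintegrand_ge0.
have sub : `]0, t] `<=` I01 R.
  move=> s; rewrite /I01/= !in_itv/= => /andP[-> st]/=.
  by apply: le_lt_trans st _; exact: I01_lt1.
have IB : ((m `^ r * (t `^ a / a))%:E <= I)%E.
  apply: (@le_trans _ _ (\int[@lebesgue_measure R]_(s in `]0%R, t])
      ((m `^ r)%:E * (s `^ (a - 1))%:E))%E).
    rewrite ge0_integralZl_EFin ?powR_ge0//.
    - rewrite EFinM; apply: lee_wpmul2l; first exact: powR_ge0.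
      exact: integral_powR_oc_ge.
    - by move=> s _; rewrite lee_fin powR_ge0.
    - exact: measurable_powR_EFin.
  apply: (@le_trans _ _ (\int[@lebesgue_measure R]_(s in `]0%R, t])
      ((s `^ (- th) * k s) `^ r * s^-1)%:E)%E).
    apply: ge0_le_integral => //.
    - by move=> s _; rewrite -EFinM lee_fin mulr_ge0 ?powR_ge0.
    - apply: emeasurable_funM; first exact: measurable_cst.
      exact: measurable_powR_EFin.
    - apply/measurable_EFinP; apply: measurable_funS sub (measurable_Kintegrand _ _).
      exact: measurable_I01.
    - move=> s st; have sI := sub _ st; have s0 := I01_gt0 sI.
      rewrite -EFinM lee_fin.
      rewrite powRB ?(gt_eqF s0) ?implybT// powRr1 ?(ltW s0)// mulrA.
      rewrite ler_wpM2r ?invr_ge0 ?(ltW s0)// powRrM -powRM ?powR_ge0//.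
      apply: ge0_ler_powR; rewrite ?nnegrE ?(ltW r0)// ?mulr_ge0 ?powR_ge0 ?k0//.
        by rewrite invr_ge0 ltW.
      rewrite powRD ?(gt_eqF s0) ?implybT// powRr1 ?(ltW s0)//.
      rewrite mulrA mulrC ler_wpM2l ?powR_ge0// /m mulrAC ler_pdivrMr//.
      rewrite mulrC [leRHS]mulrC; apply: kt => //.
      by move: st; rewrite /= in_itv/= => /andP[].
  apply: ge0_subset_integral => //.
  - exact: measurable_I01.
  - by apply/measurable_EFinP; exact: measurable_Kintegrand.
  - by move=> s sI; rewrite lee_fin Kintegrand_ge0.
have c0 : 0 <= r * th * (1 - th).
  by rewrite !mulr_ge0 ?ltW// subr_gt0.
have J0 : 0 <= m `^ r * (t `^ a / a).
  by rewrite mulr_ge0 ?powR_ge0// divr_ge0 ?powR_ge0// ltW.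
apply: (@le_trans _ _ (((r * th * (1 - th)) `^ r^-1)%:E *
    ((m `^ r * (t `^ a / a))%:E `^ r^-1))%E); last first.
  apply: lee_wpmul2l; first exact: powR_ge0.
  apply: gt0_ler_poweR => //; first by rewrite invr_ge0 ltW.
  - by rewrite in_itv/= leey lee_fin J0.
  - by rewrite in_itv/= I0 leey.
rewrite poweR_EFin -EFinM lee_fin -powRM//.
have -> : r * th * (1 - th) * (m `^ r * (t `^ a / a)) = th * (m * t `^ (1 - th)) `^ r.
  rewrite powRM ?powR_ge0// -powRrM -/a {2}/a; field.
  by rewrite !gt_eqF// subr_gt0.
have -> : t `^ (- th) * k t / 2 = 2^-1 * (m * t `^ (1 - th)).
  rewrite powRD ?(gt_eqF t0) ?implybT// powRr1 ?(ltW t0)// /m; field.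
  by rewrite gt_eqF.
set y := m * _; have y0 : 0 <= y by apply: mulr_ge0; rewrite ?powR_ge0.
have h0 : 0 <= 2^-1 :> R by rewrite invr_ge0.
rewrite -[leLHS](powRK r0); last exact: mulr_ge0.
apply: ge0_ler_powR; rewrite ?nnegrE ?powR_ge0//; first by rewrite invr_ge0 ltW.
  by rewrite mulr_ge0 ?powR_ge0// ltW.
rewrite powRM// ler_wpM2r ?powR_ge0//.
apply: le_trans thh; rewrite ge1r_powR// invr_gt0 ltr0n/=.
by rewrite invf_le1 ?ler1n.
Qed.

End Knorm_theta_bounds.

(** * Measurability of monotone functions, and the exponent theta(t) *)

Lemma nonincreasing_emeasurable (R : realType) (D : set R) (f : R -> \bar R) :
  is_interval D ->
  (forall s t, D s -> D t -> s <= t -> (f t <= f s)%E) -> measurable_fun D f.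
Proof.
move=> iD fD mD.
apply: (measurability _ (ErealGenCInfty.measurableE R)) => //.
move=> _ [_ [r ->] <-].
apply: is_interval_measurable => s t [Ds /= fs] [Dt ft] u /andP[su ut].
have Du : D u by apply: iD Ds Dt _ _; rewrite su.
split => //=; move: ft; rewrite !in_itv/= !andbT => /le_trans; apply.
exact: fD.
Qed.

Lemma is_interval_I01 (R : realType) : is_interval (I01 R).
Proof. exact: interval_is_interval. Qed.

Section theta.
Variable R : realType.
Implicit Types s t : R.

Lemma thetaE t : 0 < t -> theta t = 1 - (2 * (1 - ln t))^-1.
Proof.
move=> t0; rewrite /theta ln_div ?posrE ?expR_gt0// expRK; congr (_ + _).
by rewrite -opprB mulrN invrN.
Qed.

Lemma theta_itv t : I01 R t -> 2^-1 < theta t < 1.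
Proof.
move=> tI; have t0 := I01_gt0 tI; rewrite thetaE//.
have l0 : ln t < 0 by rewrite ln_lt0// t0 I01_lt1.
have d0 : 0 < 2 * (1 - ln t) by rewrite mulr_gt0// subr_gt0 (lt_trans l0).
rewrite ltrBlDr ltrDl invr_gt0 d0 andbT ltrBrDr -ltrBrDl.
rewrite [X in _ < X](_ : _ = 2^-1); last by field.
by rewrite ltf_pV2 ?posrE// -[ltLHS]mulr1 ltr_pM2l// ltrBrDr gtrDl.
Qed.

Lemma theta_nincr s t : I01 R s -> I01 R t -> s <= t -> theta t <= theta s.
Proof.
move=> sI tI st; have s0 := I01_gt0 sI; have t0 := I01_gt0 tI.
rewrite !thetaE// lerD2l lerN2.
have d0 u : I01 R u -> 0 < 2 * (1 - ln u).
  move=> uI; have : ln u < 0 by rewrite ln_lt0// I01_gt0//= I01_lt1.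
  by move=> ?; lra.
by rewrite lef_pV2 ?posrE ?d0// ler_pM2l// lerD2l lerN2 ler_ln.
Qed.

Lemma measurable_theta : measurable_fun (I01 R) (@theta R).
Proof.
apply/measurable_EFinP; apply: nonincreasing_emeasurable.
  exact: is_interval_I01.
by move=> s t sI tI st; rewrite lee_fin theta_nincr.
Qed.

(** The exponent (1 - theta) ln t equals ln t / (2 (1 - ln t)), which stays above -1/2. Thus
    theta(t) tends to 1 slowly enough for the norm to be estimated, yet fast enough for t^(1 -
    theta) to stay away from 0. *)
Lemma powR_onem_theta_ge t : I01 R t -> expR (- 2^-1) <= t `^ (1 - theta t).
Proof.
move=> tI; have t0 := I01_gt0 tI.
have l0 : ln t < 0 by rewrite ln_lt0// t0 I01_lt1.
have d0 : 0 < 1 - ln t by lra.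
rewrite /powR gt_eqF// ler_expR thetaE// opprB addrC subrK.
rewrite mulrC ler_pdivlMr; lra.
Qed.

End theta.

(** * Measurability in t of the (theta(t), q) norm *)

Section measurable_Knorm_theta.
Variables (R : realType) (A : banach_pair R) (x : ambient A) (k : R -> R).
Hypothesis mk : measurable_fun (I01 R) k.
Hypothesis Kk : forall s, I01 R s -> Kfun s x = (k s)%:E.
Hypothesis k0 : forall s, I01 R s -> 0 <= k s.

Lemma powRN_theta_nincr (s t u : R) : I01 R s -> I01 R t -> I01 R u -> s <= t ->
  u `^ (- theta t) <= u `^ (- theta s).
Proof.
move=> sI tI uI st; apply: ger_powR; last by rewrite lerN2 theta_nincr.
by rewrite I01_gt0//= ltW// I01_lt1.
Qed.

(** No joint measurability is involved: apart from the normalizing constant, the norm is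
    nonincreasing in t, because theta is nonincreasing and u^(-theta) increases with theta for u <
    1. The constant is a measurable function of theta. *)
Lemma measurable_Knorm_theta (q : \bar R) : (1 <= q)%E ->
  measurable_fun (I01 R) (fun t => t%:E * Knorm_theta (theta t) q x)%E.
Proof.
move=> q1; apply: emeasurable_funM; first exact: EFin_measurable.
case: q q1 => [r| |] r1; last 2 first.
- apply: nonincreasing_emeasurable; first exact: is_interval_I01.
  move=> s t sI tI st; apply: ge_ereal_sup => _ [u uI <-].
  apply: le_ereal_sup_tmp; eexists; first by exists u; [exact: uI|reflexivity].
  by rewrite Kk// lee_fin ler_wpM2r ?k0// powRN_theta_nincr.
- by [].
rewrite lee_fin in r1.
have r0 : 0 < r by exact: lt_le_trans r1.
under eq_fun do rewrite (Knorm_theta_EFin Kk).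
apply: emeasurable_funM.
  apply/measurable_EFinP; apply: (measurableT_comp (measurable_powR r^-1)).
  apply: measurable_funM; first apply: measurable_funM => //.
    exact: measurable_theta.
  by apply: measurable_funB => //; exact: measurable_theta.
apply: nonincreasing_emeasurable; first exact: is_interval_I01.
move=> s t sI tI st; apply: ge0_le_poweR; first by rewrite invr_ge0 ltW.
  by apply: integral_ge0 => u uI; rewrite lee_fin; exact: Kintegrand_ge0.
apply: ge0_le_integral.
- exact: measurable_I01.
- by move=> u uI; rewrite lee_fin; exact: Kintegrand_ge0.
- by apply/measurable_EFinP; exact: measurable_Kintegrand.
- by apply/measurable_EFinP; exact: measurable_Kintegrand.
- move=> u uI; rewrite lee_fin; apply: ler_wpM2r.
    by rewrite invr_ge0 ltW// I01_gt0.
  apply: ge0_ler_powR; rewrite ?nnegrE ?(ltW r0) ?mulr_ge0 ?powR_ge0 ?k0//.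
  by rewrite ler_wpM2r ?k0// powRN_theta_nincr.
Qed.

End measurable_Knorm_theta.

(** * Almost everywhere statements on (0,1) *)

Section ae01.
Variable R : realType.
Implicit Types (P : R -> Prop) (f : R -> R).
Local Notation mu := (@lebesgue_measure R).

#[local] Instance ae_lebesgue_filter :
  Filter (almost_everywhere (T := measurableTypeR R) mu).
Proof. exact: ae_filter_ringOfSetsType. Qed.

(** A null set contains no interval of positive length. This provides a single point of a prescribed
    interval at which almost everywhere facts hold. *)
Lemma ae01_ex P (a b : R) : 0 <= a -> a < b -> b <= 1 -> ae01 P ->
  exists2 t, a < t < b & P t.
Proof.
move=> a0 ab b1 [N [mN N0 PN]]; apply: contrapT => nP.
have : (mu `]a, b[ <= mu N)%E.
  apply: le_measure; rewrite ?inE//.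
  move=> t; rewrite /= in_itv/= => /andP[at1 tb]; apply: PN => /= tP; apply: nP.
  exists t; first by rewrite at1.
  by apply: tP; rewrite /I01/= in_itv/= (le_lt_trans a0)//= (lt_le_trans tb).
by rewrite N0 lebesgue_measure_itv/= lte_fin ab -EFinD lee_fin subr_le0 leNgt ab.
Qed.

Lemma ae01_all P : (forall t, I01 R t -> P t) -> ae01 P.
Proof. by move=> ?; exact: nearW. Qed.

Lemma ae01_mp P (Q : R -> Prop) : ae01 P ->
  (forall t, I01 R t -> P t -> Q t) -> ae01 Q.
Proof. by rewrite /ae01 => aeP PQ; apply: filterS aeP => t Pt tI; apply/PQ/Pt. Qed.

Lemma ae01_and P (Q : R -> Prop) : ae01 P -> ae01 Q ->
  ae01 (fun t => P t /\ Q t).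
Proof. by rewrite /ae01 => aeP aeQ; apply: filterS2 aeP aeQ => t Pt Qt tI; split; auto. Qed.

Lemma ae01_foralln (P : nat -> R -> Prop) : (forall n, ae01 (P n)) ->
  ae01 (fun t => forall n, P n t).
Proof.
rewrite /ae01 => /(@ae_foralln _ (measurableTypeR R)).
by apply: filterS => t Pt tI n; exact: Pt.
Qed.

Lemma Linfty_norm01_leP f (B : R) : 0 <= B ->
  (Linfty_norm01 f <= B%:E)%E <-> ae01 (fun t => `|f t| <= B).
Proof.
(* At exponent +oo, [Lnorm] is the essential supremum when the whole space has positive measure. *)
move=> B0; have mu0 : (0 < mu [set: R])%E.
  apply: (@lt_le_trans _ _ (mu `]0, 1[)).
    by rewrite lebesgue_measure_itv/= lte_fin ltr01 -EFinD lte_fin subr0.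
  by apply: le_measure; rewrite ?inE.
rewrite /Linfty_norm01 /ae01 unlock mu0; split.
  move/ess_supP; apply: filterS => t /= + tI.
  by rewrite patchE mem_set// lee_fin.
move=> aef; apply/ess_supP; apply: filterS aef => t /= ft.
by rewrite patchE lee_fin; case: ifPn => [/set_mem/ft//|_]; rewrite normr0.
Qed.

End ae01.

(** * Norm estimates and geometric series in a Banach function lattice *)

Section banach_function_lattice.
Variables (R : realType) (F : banach_function_lattice R).
Implicit Types f g : R -> R.

(** Nonnegativity is not a field of the record; it follows from 0 = ||f - f|| <= 2 ||f||. *)
Lemma bfl_norm_ge0 f : bfl_set F f -> 0 <= bfl_norm F f.
Proof.
move=> Ff; have := bfl_normD Ff (bfl_scale (-1) Ff).
rewrite bfl_normZ// normrN1 mul1r.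
rewrite (_ : (fun t => _) = (fun t => 0 * f t)); last first.
  by apply/funext => t; rewrite mulN1r subrr mul0r.
by rewrite bfl_normZ// normr0 mul0r -mulr2n pmulrn_lge0.
Qed.

Lemma bfl_sub f g : bfl_set F f -> bfl_set F g ->
  bfl_set F (fun t => f t - g t).
Proof.
move=> Ff Fg; rewrite (_ : (fun t => _) = (fun t => f t + -1 * g t)).
  by apply: bfl_add => //; exact: bfl_scale.
by apply/funext => t; rewrite mulN1r.
Qed.

Lemma bfl_normB f g : bfl_set F f -> bfl_set F g ->
  bfl_norm F (fun t => f t - g t) <= bfl_norm F f + bfl_norm F g.
Proof.
move=> Ff Fg; rewrite (_ : (fun t => _) = (fun t => f t + -1 * g t)).
  apply: le_trans (bfl_normD Ff (bfl_scale (-1) Fg)) _.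
  by rewrite bfl_normZ// normrN1 mul1r.
by apply/funext => t; rewrite mulN1r.
Qed.

(* [u n <= G] holds because the partial sums increase to [G]: the positive part
   of [S m - G] is bounded by [`|S n - G|] for every [n >= m]. *)
Lemma bfl_geometric_majorant (u : nat -> R -> R) (B : R) :
  (forall n, bfl_set F (u n)) ->
  (forall n t, I01 R t -> 0 <= u n t) ->
  (forall n, bfl_norm F (u n) <= B * 2^-1 ^+ n) ->
  exists G, [/\ bfl_set F G, bfl_norm F G <= 2 * B &
    ae01 (fun t => forall n, u n t <= G t)].
Proof.
move=> Fu u0 uB.
have B0 : 0 <= B.
  by apply: le_trans (bfl_norm_ge0 (Fu 0)) _; rewrite -[leRHS]mulr1; exact: uB.
pose S n t := \sum_(i < n) u i t.
have SS n : S n.+1 = (fun t => S n t + u n t).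
  by apply/funext => t; rewrite /S big_ord_recr.
have FS n : bfl_set F (S n).
  elim: n => [|n ih]; last by rewrite SS; exact: bfl_add.
  rewrite (_ : S 0 = (fun=> 0)); first exact: bfl_0.
  by apply/funext => t; rewrite /S big_ord0.
have S0 t : S 0 t = 0 by rewrite /S big_ord0.
have h0 : 0 <= 2^-1 :> R by rewrite invr_ge0.
(* The right-hand side is exactly B times the sum of 2^-i over m <= i < n. *)
have Sle m n : (m <= n)%N ->
    bfl_norm F (fun t => S n t - S m t) <= 2 * B * (2^-1 ^+ m - 2^-1 ^+ n).
  move=> /subnKC <-; elim: (n - m)%N => [|j ih].
    rewrite addn0 subrr mulr0 (_ : (fun t => _) = (fun t => 0 * S 0 t)).
      by rewrite bfl_normZ// normr0 mul0r.
    by apply/funext => t; rewrite subrr mul0r.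
  rewrite addnS (_ : (fun t => _) = (fun t => (S (m + j)%N t - S m t) + u (m + j)%N t)).
    apply: le_trans (bfl_normD (bfl_sub (FS _) (FS _)) (Fu _)) _.
    apply: le_trans (lerD ih (uB _)) _.
    by rewrite exprS; lra.
  by apply/funext => t; rewrite SS addrAC.
have Smono m n t : I01 R t -> (m <= n)%N -> S m t <= S n t.
  move=> tI /subnKC <-; elim: (n - m)%N => [|j ih]; first by rewrite addn0.
  by rewrite addnS SS (le_trans ih)// lerDl u0.
have hcvg : 2^-1 ^+ n @[n --> \oo] --> (0 : R).
  by apply: cvg_expr; rewrite ger0_norm// invf_lt1// ltr1n.
have [|G FG SG] := bfl_complete FS.
  move=> e e0.
  have [N _ hN] : \forall n \near \oo, 2 * B * 2^-1 ^+ n < e.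
    have : 2 * B * 2^-1 ^+ n @[n --> \oo] --> 2 * B * 0 by exact: cvgMr.
    by rewrite mulr0 => /cvgr_lt; exact.
  exists N => m n Nm Nn.
  have main i j : (N <= i)%N -> (i <= j)%N ->
      bfl_norm F (fun t => S j t - S i t) < e.
    move=> Ni ij; apply: le_lt_trans (Sle _ _ ij) _.
    apply: le_lt_trans (hN _ Ni).
    by rewrite ler_wpM2l ?mulr_ge0// gerBl exprn_ge0.
  have [mn|/ltnW nm] := leqP m n; last exact: main.
  rewrite (_ : (fun t => _) = (fun t => -1 * (S n t - S m t))); last first.
    by apply/funext => t; rewrite mulN1r opprB.
  by rewrite bfl_normZ ?normrN1 ?mul1r; [exact: main|exact: bfl_sub].
have FSG n : bfl_set F (fun t => S n t - G t) by exact: bfl_sub.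
exists G; split => //.
  (* The bound on [G] is the limit of ||G|| <= ||S n|| + ||S n - G|| <= 2 B + ||S n - G||. *)
  have cv : 2 * B + bfl_norm F (fun t => S n t - G t) @[n --> \oo] --> 2 * B + 0.
    by apply: cvgD => //; exact: cvg_cst.
  rewrite addr0 in cv; rewrite -(cvg_lim _ cv)//.
  apply: limr_ge; first by apply/cvg_ex; eexists; exact: cv.
  apply: nearW => n.
  rewrite [in leLHS](_ : G = (fun t => S n t - (S n t - G t))); last first.
    by apply/funext => t; rewrite opprB addrC subrK.
  apply: le_trans (bfl_normB (FS _) (FSG _)) _; rewrite lerD2r.
  rewrite (_ : S n = (fun t => S n t - S 0 t)); last first.
    by apply/funext => t; rewrite S0 subr0.
  apply: le_trans (Sle _ _ (leq0n n)) _.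
  by rewrite ler_piMr ?mulr_ge0// expr0 gerBl exprn_ge0.
suff SleG m : ae01 (fun t => S m t <= G t).
  apply: ae01_mp (ae01_foralln SleG) _ => t tI SGt n.
  apply: le_trans (SGt n.+1); rewrite SS lerDr.
  by apply: le_trans (Smono 0 n _ tI (leq0n n)); rewrite S0.
pose P t := Num.max (S m t - G t) 0.
have mP : measurable_fun (I01 R) P.
  by apply: measurable_maxr => //; exact: bfl_measurable (FSG m).
have PS n : (m <= n)%N -> bfl_set F P /\
    bfl_norm F P <= bfl_norm F (fun t => S n t - G t).
  move=> mn; apply: bfl_ideal => //; apply: ae01_all => t tI.
  rewrite ger0_norm ?le_max ?lexx ?orbT// /P ge_max normr_ge0 andbT.
  by apply: le_trans (ler_norm _); rewrite lerB// Smono.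
have P0 : bfl_norm F P = 0.
  apply/eqP; rewrite eq_le bfl_norm_ge0 ?andbT; last by case: (PS m (leqnn m)).
  rewrite -(cvg_lim _ SG)//; apply: limr_ge; first by apply/cvg_ex; eexists; exact: SG.
  by exists m => // n /= mn; case: (PS _ mn).
apply: ae01_mp (bfl_norm0 (PS m (leqnn m)).1 P0) _ => t tI Pt.
by rewrite -subr_le0 -Pt /P le_max lexx.
Qed.

End banach_function_lattice.

(** * The majorant in F built from the iterates of T *)

Section envelope.
Variable R : realType.
Implicit Types (k : R -> R) (s t : R).

(** Halving 1 - theta splits s^(-theta) into s^(delta - 1), which enters the majorant, and s^delta,
    which makes ds/s integrable at 0. *)
Definition delta t := (1 - theta t) / 2.

Lemma deltaE t : 0 < t -> delta t = (4 * (1 - ln t))^-1.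
Proof.
move=> t0; rewrite /delta thetaE// opprB addrC subrK -invfM.
by rewrite mulrC mulrA -natrM.
Qed.

Lemma delta_gt0 t : I01 R t -> 0 < delta t.
Proof. by move=> /theta_itv/andP[_ ?]; rewrite divr_gt0// subr_gt0. Qed.

Lemma delta_ndecr s t : I01 R s -> I01 R t -> s <= t -> delta s <= delta t.
Proof.
by move=> sI tI st; rewrite ler_wpM2r ?invr_ge0// lerD2l lerN2 theta_nincr.
Qed.

(** Doubly exponential decay beats any geometric rate: exp(y) >= y^p/p! at y = 2^n/16, with p such
    that a <= 2^p, gives exp(y) >= a^n/(p! 16^p). *)
Lemma expRN_pow2_le (a : R) : 0 < a -> exists2 C : R, 1 <= C &
  forall n, expR (- (2 ^+ n / 16)) <= C * a^-1 ^+ n.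
Proof.
move=> a0; pose p := (Num.truncn a).+1.
have ap : a <= 2 ^+ p.
  apply: (le_trans (ltW (truncnS_gt a))).
  by rewrite -natrX ler_nat ltnW// ltn_expl.
have f0 : 0 < p`!%:R :> R by rewrite ltr0n fact_gt0.
exists (p`!%:R * 16 ^+ p).
  by rewrite -natrX -natrM ler1n muln_gt0 fact_gt0 expn_gt0.
move=> n; rewrite expRN exprVn -[leRHS]invf_div lef_pV2 ?posrE ?expR_gt0//; last first.
  by rewrite divr_gt0// ?exprn_gt0// mulr_gt0// exprn_gt0.
apply: le_trans (expR_ge1Dxn (Num.truncn a) _); last by rewrite divr_ge0// exprn_ge0.
rewrite -/p ler_wpDl//.
have -> : (2 ^+ n / 16) ^+ p / p`!%:R = (2 ^+ p) ^+ n / (p`!%:R * 16 ^+ p) :> R.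
  by rewrite expr_div_n exprAC invfM -mulrA [_^-1 / _]mulrC.
rewrite ler_wpM2r ?invr_ge0 ?mulr_ge0 ?exprn_ge0//.
by rewrite lerXn2r// nnegrE ?exprn_ge0// ltW.
Qed.

(** Cross-multiplied form of k(s)/s being nonincreasing, free of division. *)
Definition ratio_nincr k := forall s t, I01 R s -> I01 R t -> s <= t ->
  s * k t <= t * k s.

Lemma I01X t n : I01 R t -> I01 R (t ^+ (2 ^ n)).
Proof.
move=> tI; rewrite /I01/= in_itv/= exprn_gt0 ?I01_gt0//=.
by rewrite exprn_ilt1 ?(I01_lt1 tI)// ?(ltW (I01_gt0 tI))// -lt0n expn_gt0.
Qed.

(** For u = t^(2^n) <= s one has k(s)/s <= k(u)/u, so the claim reduces to s^delta <= C a^(-n). The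
    least such n makes s small enough in terms of n. The constant depends on [a] alone, whereas n
    varies with s and t. *)
Lemma envelope_pointwise (a : R) : 0 < a -> exists2 C : R, 1 <= C &
  forall k s t, (forall u, I01 R u -> 0 <= k u) -> ratio_nincr k ->
  I01 R s -> I01 R t -> ln t <= -1 ->
  exists n, t * (s `^ (delta t - 1) * k s) <=
    C * (a^-1 ^+ n * (t * (k (t ^+ (2 ^ n)) / t ^+ (2 ^ n)))).
Proof.
move=> a0; have [C C1 HC] := expRN_pow2_le a0; exists C => // k s t k0 rk sI tI lt1.
have s0 := I01_gt0 sI; have t0 := I01_gt0 tI; have d0 := delta_gt0 tI.
have exn : exists n, t ^+ (2 ^ n) <= s.
  have /cvgr_le/(_ s s0) [N _ hN] : t ^+ n @[n --> \oo] --> (0 : R).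
    by apply: cvg_expr; rewrite ger0_norm ?I01_lt1// ltW.
  exists N; apply: le_trans (hN N (leqnn N)).
  by rewrite ler_wiXn2l ?(ltW t0) ?(ltW (I01_lt1 tI))// ltnW// ltn_expl.
have key n : t ^+ (2 ^ n) <= s -> s `^ delta t <= C * a^-1 ^+ n ->
    t * (s `^ (delta t - 1) * k s) <=
    C * (a^-1 ^+ n * (t * (k (t ^+ (2 ^ n)) / t ^+ (2 ^ n)))).
  move=> us sC; have uI := I01X n tI; have u0 := I01_gt0 uI.
  rewrite powRB ?(gt_eqF s0) ?implybT// powRr1 ?(ltW s0)//.
  rewrite [leLHS](_ : _ = s `^ delta t * (t * (k s / s))); last first.
    by field; rewrite gt_eqF.
  rewrite [leRHS]mulrA.
  apply: ler_pM => //; first exact: powR_ge0.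
    by apply: mulr_ge0; [exact: ltW|rewrite divr_ge0 ?k0// ltW].
  rewrite ler_wpM2l ?(ltW t0)// ler_pdivlMr// mulrC mulrA ler_pdivrMr//.
  by rewrite [leRHS]mulrC; exact: rk.
(* If n = 0 the bound s^delta <= 1 <= C suffices; otherwise minimality gives s < t^(2^(n-1)). *)
have [[|n] us nmin] := ex_minnP exn.
  exists 0; apply: key => //; rewrite expr0 mulr1; apply: le_trans C1.
  by rewrite -(powRr0 s) ger_powR ?s0 ?(ltW (I01_lt1 sI))// ltW.
exists n.+1; apply: key => //; apply: le_trans (HC _).
have su : s < t ^+ (2 ^ n).
  by rewrite ltNge; apply/negP => /nmin; rewrite ltnn.
rewrite /powR gt_eqF// ler_expR.
have : ln s <= 2 ^+ n * ln t.
  by rewrite -natrX mulr_natl -lnXn// ler_ln ?posrE ?exprn_gt0// ltW.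
move=> ls; apply: (@le_trans _ _ (delta t * (2 ^+ n * ln t))).
  by rewrite ler_wpM2l// ltW.
have p0 : 0 <= 2 ^+ n :> R by rewrite exprn_ge0.
(* Since ln t <= -1, the quotient ln t / (1 - ln t) is at most -1/2, so delta * ln t <= -1/8; the
   index shift from n to n+1 turns 8 into 16. *)
rewrite mulrCA -mulrN exprS [leRHS](_ : _ = 2 ^+ n * (- 8^-1)); last by field.
apply: ler_wpM2l => //; rewrite deltaE// mulrC ler_pdivrMr; lra.
Qed.

Variable F : banach_function_lattice R.
Hypothesis hF : is_Kparameter F.

Lemma bfl_id : bfl_set F id.
Proof.
have [[M hM] _] := hF; apply: (hM id _ _).1; first exact: measurable_id.
apply: (@le_lt_trans _ _ 1%E); last exact: ltry.
apply/Linfty_norm01_leP => //; apply: ae01_all => t /I01_gt0 t0.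
by rewrite divff ?gt_eqF// normr1.
Qed.

Lemma bfl_norm_ae_bound : exists2 M : R, 0 <= M &
  forall f, bfl_set F f -> ae01 (fun t => `|f t| <= M * bfl_norm F f).
Proof.
(* The embedding constant comes without a sign, hence the maximum with 0. *)
have [_ [M hM]] := hF; exists (Num.max M 0); first by rewrite le_max lexx orbT.
move=> f Ff; have n0 := bfl_norm_ge0 Ff.
apply/Linfty_norm01_leP; first by rewrite mulr_ge0// le_max lexx orbT.
apply: le_trans (hM _ Ff) _; rewrite lee_fin ler_wpM2r//.
by rewrite le_max lexx.
Qed.

Hypothesis hT : bounded_on F (fun (f : R -> R) (t : R) => f (t ^+ 2) / t).

(** Induction on n: if g(t) = t k(t^(2^n))/t^(2^n), then g(t^2)/t is the same expression for n+1. *)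
Lemma dilation_iterates : exists2 M : R, 0 < M &
  forall k n, bfl_set F k ->
    bfl_set F (fun t => t * (k (t ^+ (2 ^ n)) / t ^+ (2 ^ n))) /\
    bfl_norm F (fun t => t * (k (t ^+ (2 ^ n)) / t ^+ (2 ^ n))) <= M ^+ n * bfl_norm F k.
Proof.
have [M hM] := hT; exists (Num.max M 1); first by rewrite lt_max ltr01 orbT.
set L := Num.max M 1; have L0 : 0 <= L by rewrite le_max ler01 orbT.
move=> k n Fk; elim: n => [|n [Fg ng]].
  (* The function t (k(t)/t) equals k on (0,1) but may differ from it at t = 0, so the ideal
     property is used instead of an equality of functions. *)
  rewrite expr0 mul1r.
  have [] // := bfl_ideal (f := k)
    (g := fun t => t * (k (t ^+ (2 ^ 0)) / t ^+ (2 ^ 0))) Fk _ _.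
    apply: (@eq_measurable_fun _ _ _ _ _ k); last exact: bfl_measurable Fk.
    by move=> t; rewrite inE => /I01_gt0 t0; rewrite expn0 expr1 mulrC divfK ?gt_eqF.
  apply: ae01_all => t /I01_gt0 t0.
  by rewrite expn0 expr1 mulrC divfK ?gt_eqF.
have [FT nT] := hM _ Fg.
rewrite (_ : (fun t => t * _) = (fun t : R =>
    t ^+ 2 * (k ((t ^+ 2) ^+ (2 ^ n)) / (t ^+ 2) ^+ (2 ^ n)) / t)).
  split=> //; apply: (le_trans nT); rewrite exprS -mulrA.
  apply: le_trans (ler_wpM2l L0 ng); apply: ler_wpM2r; first exact: bfl_norm_ge0.
  by rewrite le_max lexx.
apply/funext => t; rewrite -!exprM -expnS; have [->|t0] := eqVneq t 0.
  by rewrite mul0r expr0n/= !mul0r.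
by field; rewrite t0 expf_neq0.
Qed.

End envelope.

Lemma bfl_envelope (R : realType) (F : banach_function_lattice R) :
  is_Kparameter F ->
  bounded_on F (fun (f : R -> R) (t : R) => f (t ^+ 2) / t) ->
  exists2 C : R, 0 < C &
  forall k, bfl_set F k -> (forall s, I01 R s -> 0 <= k s) -> ratio_nincr k ->
  exists D, [/\ bfl_set F D, bfl_norm F D <= C * bfl_norm F k &
    ae01 (fun t => forall s, I01 R s -> t * (s `^ (delta t - 1) * k s) <= D t)].
Proof.
move=> hF hT.
have [M M0 hM] := dilation_iterates hT.
(* The weight (2M)^(-n) against norms M^n ||k|| leaves the summable 2^(-n) ||k||. *)
have M20 : 0 < 2 * M by rewrite mulr_gt0.
have [C1 C11 hC1] := envelope_pointwise M20.
have C10 : 0 < C1 by exact: lt_le_trans C11.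
have [M2 M2_ge0 hM2] := bfl_norm_ae_bound hF.
have Fid := bfl_id hF; have nid := bfl_norm_ge0 Fid.
pose e2 : R := expR (- 2); have e20 : 0 < e2 by exact: expR_gt0.
pose c := C1 * (M2 * 2) / e2.
have c0 : 0 <= c by rewrite divr_ge0 ?mulr_ge0// ltW.
exists (C1 * 2 + c * bfl_norm F id).
  by rewrite ltr_pwDl ?mulr_gt0// mulr_ge0.
move=> k Fk k0 rk; have nk := bfl_norm_ge0 Fk.
pose u n t := (2 * M)^-1 ^+ n * (t * (k (t ^+ (2 ^ n)) / t ^+ (2 ^ n))).
have Fu n : bfl_set F (u n) by apply: bfl_scale; exact: (hM k n Fk).1.
have u0 n t : I01 R t -> 0 <= u n t.
  move=> tI; have t0 := I01_gt0 tI; have tn := I01X n tI.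
  rewrite mulr_ge0 ?exprn_ge0 ?invr_ge0 ?(ltW M20)//.
  by rewrite mulr_ge0 ?(ltW t0)// divr_ge0 ?k0// ltW// I01_gt0.
have nu n : bfl_norm F (u n) <= bfl_norm F k * 2^-1 ^+ n.
  have [Fg ng] := hM k n Fk.
  rewrite bfl_normZ// ger0_norm ?exprn_ge0 ?invr_ge0 ?(ltW M20)//.
  have -> : bfl_norm F k * 2^-1 ^+ n = (2 * M)^-1 ^+ n * (M ^+ n * bfl_norm F k).
    rewrite mulrA -exprMn invfM -mulrA mulVf ?gt_eqF// mulr1.
    by rewrite mulrC.
  by rewrite ler_wpM2l// exprn_ge0// invr_ge0 ltW.
have [G [FG nG uG]] := bfl_geometric_majorant Fu u0 nu.
(* The point [t1] may depend on k, but the constants use only its range: t1 < 1/e makes the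
   pointwise envelope available, and t1 > e^-2 bounds 1/t1. *)
have [t1 /andP[t1l t1r] [uG1 G1]] :
    exists2 t, e2 < t < expR (-1) & (forall n, u n t <= G t) /\
      `|G t| <= M2 * bfl_norm F G.
  apply: ae01_ex (ae01_and uG (hM2 _ FG)); first exact: ltW.
    by rewrite ltr_expR; lra.
  by rewrite expR_le1; lra.
have t10 : 0 < t1 by exact: lt_trans t1l.
have t1I : I01 R t1.
  rewrite /I01/= in_itv/= t10 (lt_trans t1r)// expR_lt1; lra.
have Phi1 s : I01 R s -> s `^ (delta t1 - 1) * k s <= c * bfl_norm F k.
  move=> sI; have [|n hn] := hC1 k s t1 k0 rk sI t1I.
    by rewrite -[leRHS]expRK ler_ln ?posrE ?expR_gt0// ltW.
  have {hn} : t1 * (s `^ (delta t1 - 1) * k s) <= C1 * (M2 * (2 * bfl_norm F k)).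
    apply: (le_trans hn); rewrite ler_wpM2l ?(ltW C10)//.
    apply: (le_trans (uG1 n)); apply: (le_trans (ler_norm _)).
    by apply: (le_trans G1); rewrite ler_wpM2l.
  rewrite mulrC -ler_pdivlMr// => /le_trans; apply.
  have -> : c * bfl_norm F k = C1 * (M2 * (2 * bfl_norm F k)) / e2.
    by rewrite /c; field; rewrite gt_eqF.
  rewrite ler_wpM2l ?mulr_ge0 ?(ltW C10)//.
  by rewrite lef_pV2 ?posrE// ltW.
(* The first term majorizes for t <= 1/e, the second for t > 1/e. *)
exists (fun t => C1 * G t + c * bfl_norm F k * t); split.
- by apply: bfl_add; exact: bfl_scale.
- apply: le_trans (bfl_normD (bfl_scale _ FG) (bfl_scale _ Fid)) _.
  rewrite !bfl_normZ// (ger0_norm (ltW C10)) (ger0_norm (mulr_ge0 c0 nk)).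
  rewrite mulrDl; apply: lerD; last by rewrite mulrAC.
  by rewrite -mulrA ler_wpM2l// ltW.
apply: ae01_mp uG _ => t tI uGt s sI; have t0 := I01_gt0 tI; have s0 := I01_gt0 sI.
have [tl|tr] := leP (ln t) (-1).
  have [n hn] := hC1 k s t k0 rk sI tI tl; apply: (le_trans hn).
  rewrite ler_wpDr ?(mulr_ge0 (mulr_ge0 c0 nk) (ltW t0))//.
  by rewrite ler_wpM2l ?(ltW C10)//; exact: uGt.
rewrite ler_wpDl//.
  by rewrite mulr_ge0 ?(ltW C10)//; apply: le_trans (uGt 0); exact: u0.
rewrite mulrC ler_wpM2r ?(ltW t0)//; apply: le_trans (Phi1 _ sI).
(* Here t > 1/e > t1, so delta t >= delta t1, and s < 1 reverses the order of the powers. *)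
rewrite ler_wpM2r ?k0// ger_powR ?s0 ?(ltW (I01_lt1 sI))// lerD2r.
apply: delta_ndecr => //; apply: (le_trans (ltW t1r)).
by rewrite -[leRHS]lnK ?posrE// ler_expR ltW.
Qed.

(** * The K-functional: finiteness, nonnegativity, monotonicity of K(t)/t *)

Section Kfun.
Variables (R : realType) (A : banach_pair R) (x : ambient A).
Hypothesis sx : sum_space x.

Lemma Kfun_fin_num (t : R) : 0 <= t -> Kfun t x \is a fin_num.
Proof.
move=> t0; rewrite ge0_fin_numE; last first.
  by apply: le_ereal_inf_tmp => _ [a _ <-]; rewrite lee_fin addr_ge0 ?mulr_ge0.
have [a0 [a1 xa]] := sx.
apply: le_lt_trans (ltry (`|a0| + t * `|a1|)).
by apply: ereal_inf_lbound; exists (a0, a1).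
Qed.

Lemma fine_Kfun_ge0 (t : R) : 0 <= t -> 0 <= fine (Kfun t x).
Proof.
move=> t0; apply: fine_ge0.
by apply: le_ereal_inf_tmp => _ [a _ <-]; rewrite lee_fin addr_ge0 ?mulr_ge0.
Qed.

(** For each decomposition, s (|a0| + t |a1|) <= t (|a0| + s |a1|) when s <= t; then take the
    infimum on the right. *)
Lemma ratio_nincr_Kfun : ratio_nincr (fine \o (fun t : R => Kfun t x)).
Proof.
move=> s t /I01_gt0 s0 /I01_gt0 t0 st /=.
rewrite -ler_pdivrMl// -lee_fin fineK ?(Kfun_fin_num (ltW s0))//.
apply: le_ereal_inf_tmp => _ [a xa <-]; rewrite lee_fin ler_pdivrMl//.
have : fine (Kfun t x) <= `|a.1| + t * `|a.2|.
  rewrite -lee_fin fineK ?(Kfun_fin_num (ltW t0))//.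
  by apply: ereal_inf_lbound; exists a.
move=> /(ler_wpM2l (ltW s0)) /le_trans; apply.
rewrite !mulrDr mulrCA lerD2r ler_wpM2r//.
Qed.

End Kfun.

(** * The two-sided estimate in F *)

Theorem theorem1 (R : realType) (F : banach_function_lattice R)
    (hF : is_Kparameter F)
    (hT : bounded_on F (fun (f : R -> R) (t : R) => f (t ^+ 2) / t)) :
  exists c C : R, 0 < c /\ 0 < C /\
    forall (A : banach_pair R) (a : ambient A) (q : \bar R),
      Kspace F a -> (1 <= q)%E ->
      (c%:E * Knorm F a
         <= enorm F (fun t : R => t%:E * Knorm_theta (theta t) q a))%E /\
      (enorm F (fun t : R => t%:E * Knorm_theta (theta t) q a)
         <= C%:E * Knorm F a)%E.
Proof.
have [C C0 hC] := bfl_envelope hF hT.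
(* Below, e^(-1/2) bounds t^(1 - theta) and 1/2 is the loss in [Knorm_theta_ge]; above, 2 is the
   loss in [Knorm_theta_le] and C the cost of the majorant. *)
exists (expR (- 2^-1) / 2), (2 * C); split; first by rewrite divr_gt0// expR_gt0.
split=> [|A a q [sa Ka] q1]; first by rewrite mulr_gt0.
pose k : R -> R := fine \o (fun t => Kfun t a).
have [Fk ->] : bfl_set F k /\ Knorm F a = (bfl_norm F k)%:E.
  by move: Ka; rewrite /Knorm /enorm; case: ifPn => // /asboolP[].
have k0 s : I01 R s -> 0 <= k s by move=> /I01_gt0/ltW; exact: fine_Kfun_ge0.
have Kk s : I01 R s -> Kfun s a = (k s)%:E.
  by move=> /I01_gt0/ltW s0; rewrite fineK ?Kfun_fin_num.
have rk : ratio_nincr k by exact: ratio_nincr_Kfun.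
have mk : measurable_fun (I01 R) k by exact: bfl_measurable Fk.
have [D [FD nD hD]] := hC k Fk k0 rk.
set W := fun t : R => (t%:E * Knorm_theta (theta t) q a)%E.
have lowerW t : I01 R t -> ((expR (- 2^-1) / 2 * k t)%:E <= W t)%E.
  move=> tI; have t0 := I01_gt0 tI; have /andP[th1 th2] := theta_itv tI.
  have th : 2^-1 <= theta t < 1 by rewrite ltW.
  have := Knorm_theta_ge mk Kk k0 th q1 tI (fun s sI st => rk _ _ sI tI st).
  move=> /(lee_wpmul2l (ltW t0 : (0 <= t%:E)%E)); apply: le_trans.
  rewrite -EFinM lee_fin.
  have -> : t * (t `^ (- theta t) * k t / 2) = t * t `^ (- theta t) / 2 * k t.
    by field.
  rewrite ler_wpM2r ?k0// ler_wpM2r//; apply: le_trans (powR_onem_theta_ge tI) _.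
  by rewrite powRD ?(gt_eqF t0) ?implybT// powRr1 ?(ltW t0).
have upperW : ae01 (fun t => (W t <= (2 * D t)%:E)%E).
  apply: ae01_mp hD _ => t tI hDt; have t0 := I01_gt0 tI.
  have /andP[th1 th2] := theta_itv tI.
  have th : 0 < theta t < 1 by rewrite th2 andbT (lt_trans _ th1)// invr_gt0.
  have Dt0 : 0 <= D t.
    by apply: le_trans (hDt t tI); rewrite !mulr_ge0 ?powR_ge0 ?k0// ltW.
  (* The constant B of [Knorm_theta_le] is D(t)/t, so multiplying the norm by t gives at most 2
     D(t). *)
  have hB s : I01 R s ->
      s `^ (- theta t) * k s <= D t / t * s `^ ((1 - theta t) / 2).
    move=> sI; have s0 := I01_gt0 sI.
    rewrite -/(delta t) (_ : - theta t = (delta t - 1) + delta t); last first.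
      by rewrite /delta; field.
    rewrite powRD ?(gt_eqF s0) ?implybT// mulrAC ler_wpM2r ?powR_ge0//.
    by rewrite ler_pdivlMr// mulrC; exact: hDt.
  have := Knorm_theta_le mk Kk k0 th q1 (divr_ge0 Dt0 (ltW t0)) hB.
  move=> /(lee_wpmul2l (ltW t0 : (0 <= t%:E)%E)) /le_trans; apply.
  rewrite -EFinM lee_fin [leLHS](_ : _ = 2 * D t)//.
  by field; rewrite gt_eqF.
have W0 t : I01 R t -> (0 <= W t)%E.
  move=> tI; apply: le_trans (lowerW t tI).
  by rewrite lee_fin mulr_ge0 ?k0// divr_ge0 ?expR_ge0.
have finW : ae01 (fun t => W t \is a fin_num).
  apply: ae01_mp upperW _ => t tI Wt.
  by rewrite ge0_fin_numE ?W0//; apply: le_lt_trans Wt (ltry _).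
have mW : measurable_fun (I01 R) (fine \o W).
  by apply: measurableT_comp (measurable_Knorm_theta mk Kk k0 q1).
(* Finiteness almost everywhere and membership in F select the finite branch of [enorm]. *)
have [FW nW] : bfl_set F (fine \o W) /\
    bfl_norm F (fine \o W) <= bfl_norm F (fun t => 2 * D t).
  apply: bfl_ideal => //; first exact: bfl_scale.
  apply: ae01_mp (ae01_and finW upperW) _ => t tI [fW Wt] /=.
  rewrite ger0_norm ?fine_ge0 ?W0//; apply: le_trans (ler_norm _).
  by rewrite -lee_fin fineK.
rewrite /enorm asboolT//; split; rewrite -EFinM lee_fin.
  rewrite -[_ / 2]ger0_norm ?divr_ge0 ?expR_ge0// -bfl_normZ//.
  apply: (bfl_ideal FW _ _).2.
    by apply: measurable_funM.
  apply: ae01_mp finW _ => t tI fW /=.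
  rewrite !ger0_norm ?fine_ge0 ?W0 ?mulr_ge0 ?k0 ?divr_ge0 ?expR_ge0//.
  by rewrite -lee_fin fineK//; exact: lowerW.
apply: (le_trans nW); rewrite bfl_normZ// ger0_norm// -mulrA.
by rewrite ler_wpM2l.
Qed.
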